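(* If $\phi$ is a sequentially congruent partition, then its conjugate $\phi^*$ satisfies $m_i(\phi^* )\equiv0\pmod i$ for every $i\ge1$. Conversely, if a partition $\mu$ satisfies $m_i(\mu)\equiv0\pmod i$ for every $i\ge1$, then its conjugate $\mu^*$ is sequentially congruent.
   Context: A partition $\phi=(\phi_1,\dots,\phi_r)$, $\phi_1\ge\dots\ge\phi_r\ge1$, is sequentially congruent if $\phi_i\equiv\phi_{i+1}\pmod i$ for $1\le i\le r-1$ and $\phi_r\equiv0\pmod r$ (the empty partition included). $m_i(\mu)$ denotes the multiplicity of $i$ as a part of $\mu$. The conjugate of a partition is the partition whose Ferrers–Young diagram is the transpose. *)

(* Defs.v *)
From HB Require Import structures.
From mathcomp Require Import all_boot.

Set Implicit Arguments.
Unset Strict Implicit.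
Unset Printing Implicit Defensive.

Definition is_part (s : seq nat) : bool :=
  sorted geq s && all (fun p => 0 < p) s.

Record intpart : Type := IntPart { parts :> seq nat; _ : is_part parts }.

HB.instance Definition _ := [isSub for parts].
HB.instance Definition _ := [Equality of intpart by <:].

(* Parts are numbered from 1: [part phi 1] is the largest one. The value is 0
   beyond the last part. *)
Definition part (phi : intpart) (i : nat) : nat := nth 0 phi i.-1.

Definition mult (i : nat) (mu : intpart) : nat := count_mem i mu.

(* The cell (i, j), in row i and column j counted from 1, belongs to the
   diagram when 1 <= j <= phi_i. *)
Definition ferrers (phi : intpart) (i j : nat) : bool :=
  [&& 0 < i, 0 < j & j <= part phi i].

(* The j-th part of the conjugate is the length of the j-th column of the
   diagram, for 1 <= j <= phi_1. By [ferrers_conj] and [ferrers_inj] below,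
   [conj_part phi] is the unique partition with the transposed diagram. *)
Definition conj_seq (s : seq nat) : seq nat :=
  [seq count (fun p => j <= p) s | j <- iota 1 (head 0 s)].

Lemma conj_seqP (s : seq nat) : is_part (conj_seq s).
Proof.
apply/andP; split.
  rewrite /conj_seq sorted_map.
  apply: (@sub_sorted _ leq); last exact: iota_sorted.
  by move=> i j le_ij /=; apply: sub_count => p /=; apply: leq_trans.
apply/allP => n /mapP[j]; rewrite mem_iota => /andP[j_gt0 lt_j] ->.
case: s lt_j => [|p s] /=; first by rewrite ltnNge j_gt0.
by rewrite add1n ltnS => ->.
Qed.

Definition conj_part (phi : intpart) : intpart := IntPart (conj_seqP phi).

Lemma count_geq_gt (s : seq nat) (i j : nat) :
  sorted geq s -> 0 < j -> (i < count (fun p => j <= p) s) = (j <= nth 0 s i).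
Proof.
move=> + j_gt0; elim: s i => [|p s IHs] i /=.
  by rewrite nth_nil; case: j j_gt0.
rewrite path_sortedE; last by move=> x y z /= h1 h2; apply: leq_trans h2 h1.
move=> /andP[/allP p_max s_sorted]; case: (leqP j p) => [le_jp|lt_pj].
  by case: i => [|i] /=; rewrite add1n ?le_jp // ltnS IHs.
have /eqP -> : count (fun x => j <= x) s == 0.
  rewrite -leqn0 leqNgt -has_count; apply/hasPn => x /p_max /= le_xp.
  by rewrite -ltnNge (leq_ltn_trans le_xp lt_pj).
case: i => [|i] /=; rewrite addn0 ltn0; apply/esym/negbTE; rewrite -ltnNge //.
case: (ltnP i (size s)) => [lt_i|ge_i]; last by rewrite nth_default.
exact: leq_ltn_trans (p_max _ (mem_nth 0 lt_i)) lt_pj.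
Qed.

Lemma ferrers_conj (phi : intpart) (i j : nat) :
  ferrers (conj_part phi) i j = ferrers phi j i.
Proof.
rewrite /ferrers /part andbCA; case: j => //= j; case: i => //= i.
case: phi => s /= /andP[s_sorted _].
rewrite /conj_seq; case: (ltnP i (head 0 s)) => [lt_i|ge_i].
  rewrite (nth_map 0) ?size_iota // nth_iota // add1n.
  exact: count_geq_gt.
rewrite nth_default ?size_map ?size_iota // ltn0 -count_geq_gt //.
suff /eqP -> : count (fun p => i < p) s == 0 by [].
by rewrite -leqn0 leqNgt count_geq_gt // nth0 -leqNgt.
Qed.

Lemma ferrers_inj (phi psi : intpart) : ferrers phi =2 ferrers psi -> phi = psi.
Proof.
move=> eqF; apply: val_inj => /=.
have eq_nth i : nth 0 phi i = nth 0 psi i.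
  apply/eqP; rewrite eqn_leq; apply/andP; split.
    case E: (nth 0 phi i) => [|k] //.
    by have := eqF i.+1 k.+1; rewrite /ferrers /part /= E leqnn => /esym.
  case E: (nth 0 psi i) => [|k] //.
  by have := eqF i.+1 k.+1; rewrite /ferrers /part /= E leqnn.
have lt_size (mu : intpart) i : (i < size mu) = (0 < nth 0 mu i).
  case: mu => s /= /andP[_ /allP s_gt0]; case: ltnP => [lt_i|ge_i].
    by rewrite s_gt0 ?mem_nth.
  by rewrite nth_default.
apply: (@eq_from_nth _ 0) => [|i _]; last exact: eq_nth.
apply/eqP; rewrite eqn_leq; apply/andP; split.
  by rewrite leqNgt lt_size eq_nth -lt_size ltnn.
by rewrite leqNgt lt_size -eq_nth -lt_size ltnn.
Qed.

(* Both conditions hold trivially for the empty partition. *)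
Definition seq_congruent (phi : intpart) : Prop :=
  (forall i : nat, 1 <= i <= (size phi).-1 ->
     part phi i = part phi i.+1 %[mod i]) /\
  part phi (size phi) = 0 %[mod size phi].

(* Main.v *)
Require Import Defs.
From mathcomp Require Import all_boot.

(** The last part of a partition satisfies the same congruence as the others
    once the partition is padded with zeros, so [phi] is sequentially congruent
    iff [i] divides [phi_i - phi_(i+1)] for every [i >= 1]; and this difference
    of row lengths is the number of columns of length [i], i.e. the
    multiplicity of [i] in the conjugate. *)

Lemma conj_partK : involutive conj_part.
Proof. by move=> phi; apply: ferrers_inj => i j; rewrite !ferrers_conj. Qed.

Lemma part_conj (mu : intpart) (i : nat) :
  0 < i -> part (conj_part mu) i = count (leq i) mu.
Proof.
move=> i_gt0.
(* Numbers with the same strict lower bounds are equal; [k] lies below the left one exactly when the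
   cell [(i, k.+1)] is in the conjugate diagram. *)
have eq_lt k : (k < part (conj_part mu) i) = (k < count (leq i) mu).
  have := ferrers_conj mu i k.+1; rewrite /ferrers i_gt0 /= => ->; rewrite /part.
  by case: mu => s /= /andP[s_sorted _]; rewrite count_geq_gt.
by apply/eqP; rewrite eqn_leq leqNgt eq_lt ltnn leqNgt -eq_lt ltnn.
Qed.

(** The parts [>= i] of the conjugate split into those equal to [i] and those [>= i.+1]; by
    [part_conj], the counts of parts [>= i] and [>= i.+1] are row lengths of [phi]. *)
Lemma mult_conj_part (phi : intpart) (i : nat) :
  0 < i -> mult i (conj_part phi) + part phi i.+1 = part phi i.
Proof.
move=> i_gt0; rewrite -{2 3}(conj_partK phi) !part_conj // /mult.
rewrite -count_predUI [X in _ + X](_ : _ = 0) ?addn0.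
  by apply: eq_count => p /=; rewrite [RHS]leq_eqVlt eq_sym.
rewrite -[RHS](count_pred0 (conj_part phi)); apply: eq_count => p /=.
by case: eqP => // ->; rewrite ltnn.
Qed.

Lemma seq_congruentP (phi : intpart) :
  seq_congruent phi <->
  forall i, 0 < i -> part phi i = part phi i.+1 %[mod i].
Proof.
have part_gt i : size phi < i -> part phi i = 0.
  by case: i => // i lt_i; rewrite /part nth_default.
split=> [[cong cong_last] i i_gt0 | cong].
  case: (ltngtP i (size phi)) => [lt_i | gt_i | ->].
  - by apply: cong; rewrite i_gt0 -ltnS prednK // (leq_trans _ lt_i).
  - by rewrite !part_gt // ltnW.
  - by rewrite cong_last part_gt.
split=> [i /andP[i_gt0 _] | ]; first exact: cong.
(* For the empty partition the modulus is 0, so the congruence is an equality; it holds since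
   [part phi 0] is then the default 0. *)
case: (posnP (size phi)) => [sz0 | sz_gt0]; last by rewrite cong // part_gt.
by rewrite sz0 /part nth_default ?sz0.
Qed.

Lemma seq_congruent_conj (phi : intpart) :
  seq_congruent phi <->
  forall i, 0 < i -> mult i (conj_part phi) = 0 %[mod i].
Proof.
have E i : 0 < i -> (part phi i == part phi i.+1 %[mod i]) =
                    (mult i (conj_part phi) == 0 %[mod i]).
  (* The summand [part phi i.+1] cancels on both sides. *)
  by move=> i_gt0; rewrite -mult_conj_part // -{2}[part phi _]add0n eqn_modDr.
split=> [/seq_congruentP cong i i_gt0 | cong].
  by apply/eqP; rewrite -E //; apply/eqP/cong.
by apply/seq_congruentP => i i_gt0; apply/eqP; rewrite E //; apply/eqP/cong.
Qed.

Theorem theorem4p1 :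
  (forall phi : intpart, seq_congruent phi ->
     forall i : nat, 1 <= i -> mult i (conj_part phi) = 0 %[mod i]) /\
  (forall mu : intpart, (forall i : nat, 1 <= i -> mult i mu = 0 %[mod i]) ->
     seq_congruent (conj_part mu)).
Proof.
split=> [phi /seq_congruent_conj // | mu mult_mu].
by apply/seq_congruent_conj; rewrite conj_partK.
Qed.
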